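(* Let $F(k)=(-1)^kf_k$, let $$L=(k+2)^2\sigma^2+(7k^2+21k+16)\sigma-8(k+1)^2,$$ and let $n$ be a positive integer. Then $$\sum_{k=0}^{n-1} L^{\ast}(p(k))(-1)^kf_k=-n^2\bigl(p(n-2)F(n)+8p(n-1)F(n-1)\bigr)$$ for any polynomial $p(k)\in\mathbb{Z}[k]$, where $L^{\ast}$ is the adjoint of $L$.
   Context: The Franel numbers are $f_k=\sum_{i=0}^{k}\binom{k}{i}^3$ for $k\ge 0$. $\sigma$ is the shift operator in $k$ ($\sigma F(k)=F(k+1)$). The adjoint of an operator $L=\sum_{i=0}^{J}a_i(k)\sigma^i$ with polynomial coefficients is $L^{\ast}=\sum_{i=0}^{J}\sigma^{-i}a_i(k)$, so that $L^{\ast}(p(k))=\sum_{i=0}^{J}a_i(k-i)p(k-i)$ for a polynomial $p(k)$. *)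

(* Defs.v *)
From mathcomp Require Import all_boot all_order all_algebra.
Set Implicit Arguments.
Unset Strict Implicit.
Unset Printing Implicit Defensive.
Import Order.TTheory GRing.Theory Num.Theory.
Local Open Scope ring_scope.

Definition franel (k : nat) : nat := (\sum_(i < k.+1) 'C(k, i) ^ 3)%N.

Definition signed_franel (k : nat) : int := (-1) ^+ k * (franel k)%:Z.

(* The list [:: a_0; ...; a_J] stands for \sum_(i <= J) a_i(k) sigma^i, the
   variable 'X playing the role of k. *)
Definition shift_op := seq {poly int}.

(* sigma^-i acting on polynomials: p(k) |-> p(k - i). *)
Definition unshift (i : nat) (p : {poly int}) : {poly int} :=
  p \Po ('X - (i%:Z)%:P).

(* In L^* = \sum_i sigma^-i a_i(k), the product by a_i is performed before the
   shift. *)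
Definition adjoint (L : shift_op) (p : {poly int}) : {poly int} :=
  \sum_(i < size L) unshift i (L`_i * p).

Lemma horner_adjoint (L : shift_op) (p : {poly int}) (k : int) :
  (adjoint L p).[k]
  = \sum_(i < size L) (L`_i).[k - i%:Z] * p.[k - i%:Z].
Proof.
rewrite /adjoint horner_sum; apply: eq_bigr => i _.
by rewrite /unshift horner_comp hornerM !hornerE.
Qed.

Definition franel_op : shift_op :=
  [:: - (8%:P * ('X + 1) ^+ 2);
      7%:P * 'X ^+ 2 + 21%:P * 'X + 16%:P;
      ('X + 2%:P) ^+ 2].

(* Main.v *)
(* The recurrence for the Franel numbers is obtained by creative telescoping:
   a polynomial multiple of the recurrence, applied to the summand 'C(m, k)^3,
   is the difference in k of 'C(m + 1, k)^3 times the polynomial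
   k^3 franel_cert(m, k).  The theorem then follows by induction on n: the
   increment of the right-hand side differs from the n-th summand by a multiple
   of L F(n - 1) = 0. *)
Require Import Defs.
From mathcomp Require Import all_boot all_order all_algebra.
From mathcomp Require Import ring.
Set Implicit Arguments.
Unset Strict Implicit.
Unset Printing Implicit Defensive.
Import Order.TTheory GRing.Theory Num.Theory.
Local Open Scope ring_scope.

Lemma PoszS (n : nat) : n.+1%:Z = n%:Z + 1.
Proof. by rewrite intS addrC. Qed.

Lemma natz_subn_bin (n k : nat) :
  ((n - k) * 'C(n, k))%N%:Z = (n%:Z - k%:Z) * 'C(n, k)%:Z.
Proof.
have [le_kn|lt_nk] := leqP k n; first by rewrite PoszM subzn.
by rewrite bin_small // muln0 mulr0.
Qed.

Lemma mulz_bin_down (n k : nat) :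
  n.+1%:Z * 'C(n, k)%:Z = (n.+1%:Z - k%:Z) * 'C(n.+1, k)%:Z.
Proof. by rewrite -natz_subn_bin -mul_bin_down PoszM. Qed.

Lemma mulz_bin_left (n k : nat) :
  k.+1%:Z * 'C(n, k.+1)%:Z = (n%:Z - k%:Z) * 'C(n, k)%:Z.
Proof. by rewrite -natz_subn_bin -mul_bin_left PoszM. Qed.

(* The cubic q in k, found by undetermined coefficients, that solves
   m (m+1)^5 - (7m^2+7m+2) m (m+1-k)^3 - 8 (m-k)^3 (m+1-k)^3
   = (m+1-k)^3 q(k+1) - k^3 q(k). *)
Definition franel_cert (m k : int) : int :=
  4 * k ^+ 3 - (12 + 18 * m) * k ^+ 2 + (12 + 39 * m + 27 * m ^+ 2) * k
  - (4 + 22 * m + 32 * m ^+ 2 + 14 * m ^+ 3).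

Definition franel_antidiff (n k : nat) : int :=
  (k%:Z * 'C(n.+2, k)%:Z) ^+ 3 * franel_cert n.+1%:Z k%:Z.

Lemma franel_summand_telescope (n k : nat) :
  let m := n.+1%:Z in
  m * (m + 1) ^+ 3 *
    ((m + 1) ^+ 2 * 'C(n.+2, k)%:Z ^+ 3
     - (7 * m ^+ 2 + 7 * m + 2) * 'C(n.+1, k)%:Z ^+ 3
     - 8 * m ^+ 2 * 'C(n, k)%:Z ^+ 3)
  = franel_antidiff n k.+1 - franel_antidiff n k.
Proof.
move=> m; rewrite /franel_antidiff mulz_bin_left -/m.
have := mulz_bin_down n.+1 k; have := mulz_bin_down n k.
rewrite (PoszS n.+1) (PoszS k) -/m => Hb Ha; move: Ha Hb.
move: m 'C(n, k)%:Z 'C(n.+1, k)%:Z 'C(n.+2, k)%:Z k%:Z.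
move=> m b a c x Ha Hb; rewrite /franel_cert.
(* The factor [m * (m + 1) ^+ 3] lets [Hb] and [Ha] absorb the lower binomials: every term becomes a
   multiple of [c ^+ 3], and the polynomial identity for q remains. *)
transitivity (m * (m + 1) ^+ 5 * c ^+ 3
   - (7 * m ^+ 2 + 7 * m + 2) * m * ((m + 1) * a) ^+ 3
   - 8 * ((m + 1) * (m * b)) ^+ 3); first by ring.
rewrite Hb [(m + 1) * (_ * a)]mulrCA Ha; ring.
Qed.

(** The terms beyond n vanish, so consecutive Franel numbers can share one summation range. *)
Lemma franel_widen (n N : nat) : (n <= N)%N ->
  (franel n)%:Z = \sum_(0 <= k < N.+1) 'C(n, k)%:Z ^+ 3.
Proof.
move=> le_nN; rewrite (big_cat_nat (n := n.+1)) //=.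
rewrite [X in _ + X]big_nat_cond [X in _ + X]big1 ?addr0; last first.
  by move=> k /andP[/andP[lt_nk _] _]; rewrite bin_small.
rewrite big_mkord /franel -natz natr_sum.
by apply: eq_bigr => i _; rewrite natrX natz.
Qed.

Lemma franel_rec (n : nat) :
  let m := n.+1%:Z in
  (m + 1) ^+ 2 * (franel n.+2)%:Z
  = (7 * m ^+ 2 + 7 * m + 2) * (franel n.+1)%:Z + 8 * m ^+ 2 * (franel n)%:Z.
Proof.
move=> m; have m1E : m + 1 = n.+2%:Z by rewrite (PoszS n.+1).
have nz : m * (m + 1) ^+ 3 != 0 by rewrite m1E mulf_neq0 ?expf_neq0.
apply/eqP; rewrite -subr_eq0 opprD addrA -(mulrI_eq0 _ (mulfI nz)); apply/eqP.
have le_n : (n <= n.+2)%N by rewrite -addn2 leq_addr.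
rewrite !(@franel_widen _ n.+2) // !mulr_sumr -!sumrB mulr_sumr.
rewrite (eq_bigr _ (fun k _ => franel_summand_telescope n k)) telescope_sumr //.
(* Both ends vanish: the upper one through ['C(n.+2, n.+3)], the lower one through the factor k. *)
by rewrite /franel_antidiff bin_small // mulr0 mul0r !expr0n !mul0r subr0.
Qed.

(** This is L F(n) = 0 written in m = n + 1; the alternating sign flips only the middle term. *)
Lemma signed_franel_rec (n : nat) :
  let m := n.+1%:Z in
  (m + 1) ^+ 2 * signed_franel n.+2
  + (7 * m ^+ 2 + 7 * m + 2) * signed_franel n.+1
  - 8 * m ^+ 2 * signed_franel n = 0.
Proof.
move=> m; rewrite /signed_franel !(exprS (-1)).
transitivity ((-1) ^+ n * ((m + 1) ^+ 2 * (franel n.+2)%:Z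
  - ((7 * m ^+ 2 + 7 * m + 2) * (franel n.+1)%:Z
     + 8 * m ^+ 2 * (franel n)%:Z))); first by ring.
by rewrite franel_rec subrr mulr0.
Qed.

Lemma horner_adjoint_franel (p : {poly int}) (k : int) :
  (adjoint franel_op p).[k]
  = - 8 * (k + 1) ^+ 2 * p.[k] + (7 * k ^+ 2 + 7 * k + 2) * p.[k - 1]
    + k ^+ 2 * p.[k - 2].
Proof.
rewrite horner_adjoint !big_ord_recl big_ord0 /= /bump !add1n addr0.
rewrite !(hornerD, hornerN, hornerM, horner_exp, hornerX, hornerC, =^~ polyC1).
rewrite subr0.
ring.
Qed.

Theorem theorem5 (n : nat) (n_gt0 : (0 < n)%N) (p : {poly int}) :
  \sum_(0 <= k < n)
     (adjoint franel_op p).[k%:Z] * (-1) ^+ k * (franel k)%:Z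
  = - (n%:Z ^+ 2) * (p.[n%:Z - 2] * signed_franel n
                   + 8 * p.[n%:Z - 1] * signed_franel n.-1).
Proof.
case: n n_gt0 => // n _; elim: n => [|n IHn].
  rewrite big_nat1 horner_adjoint_franel /signed_franel /franel.
  rewrite !big_ord_recl !big_ord0 /= !subrr sub0r.
  have -> : 1%:Z - 2 = - 1 by [].
  by ring.
rewrite big_nat_recr //= IHn horner_adjoint_franel -[X in _ + X = _]mulrA
  -/(signed_franel _).
have /= := signed_franel_rec n.
rewrite (PoszS n.+1).
have -> : n.+1%:Z + 1 - 2 = n.+1%:Z - 1 by ring.
rewrite addrK; move: n.+1%:Z => m rec.
apply/eqP; rewrite -subr_eq0; apply/eqP.
(* The terms in p(m) and p(m - 2) cancel between the two sides; those in p(m - 1) collect into p(m -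
   1) times the left side of [rec]. *)
rewrite -[RHS](mulr0 p.[m - 1]) -rec; ring.
Qed.
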